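(* The property of not containing odd anti-holes of size larger than five is a partite testable property for the squares of bipartite graphs. That is, for every bipartite graph $G=(A,B,E)$, if neither of the induced subgraphs $G^2[A]$ and $G^2[B]$ contains an odd anti-hole of size larger than five (as an induced subgraph), then $G^2$ does not contain an odd anti-hole of size larger than five (as an induced subgraph).
   Context: All graphs are finite, undirected and simple. The square $G^2$ of a graph $G$ has the same vertex set as $G$, and two distinct vertices are adjacent in $G^2$ iff their distance in $G$ is at most two. For $S\subseteq V(G)$, $G^2[S]$ is the subgraph of $G^2$ induced by $S$. A hole is an induced cycle of length at least four; an anti-hole is the complement of a hole; it is odd if it has an odd number of vertices, and its size is its number of vertices. A graph property $P$ is partite testable for the squares of a class $\mathcal C$ of bipartite graphs if for every $G=(A,B,E)$ in $\mathcal C$, whenever $G^2[A]$ and $G^2[B]$ satisfy $P$, then $G^2$ satisfies $P$. *)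

(* Defs.v *)
From mathcomp Require Import all_boot.

Set Implicit Arguments.
Unset Strict Implicit.
Unset Printing Implicit Defensive.

Record sgraph := SGraph {
  vertex :> finType;
  adj : rel vertex;
  adj_sym : symmetric adj;
  adj_irrefl : irreflexive adj }.

Section Operations.

Variable G : sgraph.

(* There is a walk of length at most k from x to y, i.e. d(x, y) <= k; this is
   false when x and y lie in different components. *)
Definition dist_le (k : nat) (x y : G) : bool :=
  [exists l : 'I_k.+1, [exists p : l.-tuple G,
     path (@adj G) x p && (last x p == y)]].

Lemma dist_le_sym k : symmetric (dist_le k).
Proof.
suff imp : forall x y, dist_le k x y -> dist_le k y x by move=> x y; apply/idP/idP; apply: imp.
move=> x y /existsP[l /existsP[p /andP[pathp /eqP lastp]]].
have sz : size (rev (belast x p)) == l by rewrite size_rev size_belast size_tuple.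
apply/existsP; exists l; apply/existsP; exists (Tuple sz) => /=.
rewrite -lastp rev_path (eq_path (e' := @adj G)); last by move=> u v; rewrite adj_sym.
by rewrite pathp /=; case: (tval p) => //= a q; rewrite rev_cons last_rcons.
Qed.

Definition square_rel : rel G := [rel x y | (x != y) && dist_le 2 x y].

Lemma square_sym : symmetric square_rel.
Proof. by move=> x y; rewrite /square_rel /= eq_sym dist_le_sym. Qed.

Lemma square_irrefl : irreflexive square_rel.
Proof. by move=> x; rewrite /square_rel /= eqxx. Qed.

Definition square : sgraph := SGraph square_sym square_irrefl.

Definition compl_rel : rel G := [rel x y | (x != y) && ~~ adj x y].

Lemma compl_sym : symmetric compl_rel.
Proof. by move=> x y; rewrite /compl_rel /= eq_sym adj_sym. Qed.

Lemma compl_irrefl : irreflexive compl_rel.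
Proof. by move=> x; rewrite /compl_rel /= eqxx. Qed.

Definition complement : sgraph := SGraph compl_sym compl_irrefl.

Variable S : {set G}.

Definition induced_rel : rel {x : G | x \in S} :=
  [rel x y | adj (val x) (val y)].

Lemma induced_sym : symmetric induced_rel.
Proof. by move=> x y; apply: adj_sym. Qed.

Lemma induced_irrefl : irreflexive induced_rel.
Proof. by move=> x; apply: adj_irrefl. Qed.

Definition induced : sgraph := SGraph induced_sym induced_irrefl.

End Operations.

(* ordS is the cyclic successor on 'I_n; the result is the cycle C_n only for
   n >= 3. *)
Definition cycle_rel (n : nat) : rel 'I_n :=
  [rel i j | (i != j) && ((j == ordS i) || (i == ordS j))].

Lemma cycle_sym n : symmetric (@cycle_rel n).
Proof. by move=> i j; rewrite /cycle_rel /= eq_sym orbC. Qed.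

Lemma cycle_irrefl n : irreflexive (@cycle_rel n).
Proof. by move=> i; rewrite /cycle_rel /= eqxx. Qed.

Definition cycle_graph (n : nat) : sgraph :=
  SGraph (@cycle_sym n) (@cycle_irrefl n).

Definition isomorphic (G H : sgraph) : Prop :=
  exists2 f : G -> H, bijective f & forall x y, adj (f x) (f y) = adj x y.

Definition is_hole (H : sgraph) : Prop :=
  exists2 n, 4 <= n & isomorphic H (cycle_graph n).

Definition is_antihole (H : sgraph) : Prop := is_hole (complement H).

Definition odd_antihole_gt5_free (G : sgraph) : Prop :=
  ~ exists W : {set G}, [/\ is_antihole (induced W), odd #|W| & 5 < #|W|].

(* A part may be empty. *)
Definition bipartition (G : sgraph) (A B : {set G}) : Prop :=
  [/\ A :|: B = [set: G], A :&: B = set0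
    & forall x y : G, adj x y ->
        (x \in A) && (y \in B) || (x \in B) && (y \in A)].

Definition bipartite (G : sgraph) : Prop :=
  exists A B : {set G}, bipartition A B.

Definition partite_testable (C : sgraph -> Prop) (P : sgraph -> Prop) : Prop :=
  forall (G : sgraph) (A B : {set G}), C G -> bipartition A B ->
    P (@induced (square G) A) -> P (@induced (square G) B) -> P (square G).

(* Main.v *)
Require Import Defs.
From mathcomp Require Import all_boot.
From mathcomp Require Import zmodp zify.

Set Implicit Arguments.
Unset Strict Implicit.
Unset Printing Implicit Defensive.

(** Vertices on different sides are adjacent in the square iff they are adjacent
in [G]. Hence, if two cyclically consecutive vertices of an anti-hole lie on
the same side, they have no common neighbour, so every vertex of the anti-hole
on the other side must be consecutive to one of them: only the two positions
flanking the pair are possible. An odd anti-hole does contain such a pair, say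
at positions 0 and 1; if the size is at least 7, positions 3, 4 and 5 are then
on the same side too, and the pairs (3, 4) and (4, 5) exclude the positions 2
and -1. So the whole anti-hole lies on one side. *)

(** Without a repeat [s] alternates, so [s k] is [s 0] flipped [k] times; for [k = n] odd this
    contradicts [s n = s 0]. *)
Lemma odd_periodic_repeat (n : nat) (s : nat -> bool) :
  odd n -> s n = s 0 -> exists i, s i = s i.+1.
Proof.
move=> odd_n sn0; have [/hasP[i _ /eqP]|/hasPn alt] :=
  boolP (has (fun i => s i == s i.+1) (iota 0 n)); first by exists i.
suff /(_ n (leqnn n)) : forall k, k <= n -> s k = s 0 (+) odd k.
  by rewrite sn0 odd_n; case: (s 0).
elim=> [|k IH] kn; first by rewrite addbF.
have := alt k; rewrite mem_iota /= kn (IH (ltnW kn)) => /(_ isT).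
by case: (s k.+1) (s 0) (odd k) => [] [] [].
Qed.

(** Here [s] records the side of each position. The disjunct [i == ordS j] places [j] just before
    the pair [i], [ordS i]. *)
Definition flanked (n : nat) (s : 'I_n -> bool) : Prop :=
  forall i j, s i = s (ordS i) -> s j != s i ->
    (j == ordS (ordS i)) || (i == ordS j).

Lemma ordS_inZp n i : ordS (inZp i) = inZp i.+1 :> 'I_n.+1.
Proof. by apply: val_inj; rewrite /= -addn1 modnDml addn1. Qed.

Lemma eq_inZp n i j : (inZp i == inZp j :> 'I_n.+1) = (i == j %[mod n.+1]).
Proof. by rewrite -val_eqE. Qed.

Lemma flanked_const (n : nat) (s : 'I_n -> bool) :
  odd n -> 6 < n -> flanked s -> forall i j, s i = s j.
Proof.
case: n s => // n s odd_n n_gt6 sF.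
have [|i0 si0] := @odd_periodic_repeat n.+1 (s \o inZp) odd_n.
  by congr s; apply/eqP; rewrite eq_inZp modnn mod0n.
(* Rotate so that the repeated pair sits at positions 0 and 1. The size is now [n.+1], so position
   [n] plays the role of -1. *)
pose t k := s (inZp (i0 + k)).
have tF i j : t i = t i.+1 -> t j != t i ->
    (j == i.+2 %[mod n.+1]) || (i == j.+1 %[mod n.+1]).
  rewrite /t addnS -ordS_inZp => /sF/[apply].
  by rewrite !ordS_inZp -!addnS !eq_inZp !eqn_modDl.
have t01 : t 0 = t 1 by rewrite /t addn0 addn1.
have flank0 j : j < n.+1 -> t j != t 0 -> (j == 2) || (j == n).
  move=> jn /(tF 0 j t01); rewrite mod0n !(modn_small jn) modn_small; last lia.
  case/orP=> [->//|]; case: (ltngtP j n) => [jn'||->]; rewrite ?orbT //; last lia.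
  by rewrite modn_small.
have [t3 t4 t5] : [/\ t 3 = t 0, t 4 = t 0 & t 5 = t 0].
  by split; apply/eqP; apply: contraT => /flank0; lia.
have tconst j : j < n.+1 -> t j = t 0.
  move=> jn; apply/eqP; apply: contraT => tj0.
  (* The pair (3, 4) is flanked by 2 and 5, so it excludes [n]; the pair (4, 5) is flanked by 3 and
     6, so it excludes 2. Both are needed: at size 7, position [n] is 6. *)
  have := tF 3 j; rewrite t3 t4 tj0 => /(_ erefl isT).
  have := tF 4 j; rewrite t4 t5 tj0 => /(_ erefl isT).
  have /orP[/eqP->|/eqP->] := flank0 j jn tj0; rewrite ?modnn !modn_small; lia.
suff all0 i : s i = t 0 by move=> i j; rewrite !all0.
(* Undo the rotation: the index is [i - i0] modulo [n.+1], with [i0] reduced first so that the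
   subtraction is not truncated. *)
have -> : s i = t ((i + (n.+1 - i0 %% n.+1)) %% n.+1).
  rewrite /t; congr s; apply: val_inj => /=.
  have r_lt : i0 %% n.+1 < n.+1 by rewrite ltn_mod.
  rewrite modnDmr {1}(divn_eq i0 n.+1).
  have -> : i0 %/ n.+1 * n.+1 + i0 %% n.+1 + (i + (n.+1 - i0 %% n.+1))
    = (i0 %/ n.+1).+1 * n.+1 + i by rewrite mulSn; lia.
  by rewrite modnMDl modn_small.
by apply: tconst; rewrite ltn_mod.
Qed.

Lemma square_adjP (G : sgraph) (x y : G) :
  reflect (x != y /\ (adj x y \/ exists z, adj x z /\ adj z y))
    (@adj (square G) x y).
Proof.
apply: (iffP andP) => -[xy]; last first.
  move=> D; split=> //; case: D => [axy|[z [axz azy]]].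
  - apply/existsP; exists (inord 1); apply/existsP.
    by rewrite inordK //; exists [tuple y]; rewrite /= axy eqxx.
  - apply/existsP; exists (inord 2); apply/existsP.
    by rewrite inordK //; exists [tuple z; y]; rewrite /= axz azy eqxx.
case/existsP=> l /existsP[p /andP[pathp /eqP lastp]]; split=> //.
have : size p <= 2 by rewrite size_tuple -ltnS.
case: (tval p) pathp lastp => [|a [|b [|//]]] /=.
- by move=> _ E; rewrite E eqxx in xy.
- by rewrite andbT => ? <-; left.
- by rewrite andbT => /andP[? ?] <-; right; exists a.
Qed.

Section Bipartite.

Variables (G : sgraph) (A B : {set G}).
Hypothesis AB : bipartition A B.

Lemma bipartition_compl x : (x \in B) = (x \notin A).
Proof.
case: AB => /setP/(_ x) + /setP/(_ x) + _; rewrite !inE.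
by case: (x \in A); case: (x \in B).
Qed.

Lemma bipartition_adj x y : adj x y -> (y \in A) = (x \notin A).
Proof.
case: AB => _ _ /[apply]; rewrite !bipartition_compl.
by case: (x \in A); case: (y \in A).
Qed.

(** A walk of length two in a bipartite graph returns to the side it started from. *)
Lemma square_adj_cross x y :
  (x \in A) != (y \in A) -> @adj (square G) x y -> adj x y.
Proof.
move=> xy /square_adjP[_ [//|[z [/bipartition_adj xz /bipartition_adj zy]]]].
by move: xy; rewrite zy xz negbK eqxx.
Qed.

Lemma square_antihole_flanked n (v : 'I_n -> G) :
  1 < n -> injective v ->
  (forall i j, @adj (square G) (v i) (v j) =
     (i != j) && ~~ cycle_rel i j) ->
  flanked (fun i => v i \in A).
Proof.
move=> n_gt1 v_inj adjv i j sameA diffA; apply: contraT; rewrite negb_or => /andP[jSSi iSj].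
have ij : i != j by apply: contra diffA => /eqP->.
have Sij : ordS i != j by apply: contra diffA => /eqP<-; rewrite sameA.
have ijA : adj (v i) (v j).
  apply: square_adj_cross; first by rewrite eq_sym.
  by rewrite adjv /cycle_rel /= ij (eq_sym j) negb_or Sij iSj.
have SijA : adj (v (ordS i)) (v j).
  apply: square_adj_cross; first by rewrite -sameA eq_sym.
  rewrite adjv /cycle_rel /= Sij negb_or jSSi /=.
  by rewrite (inj_eq (@ordS_inj n)).
have iSi : i != ordS i.
  apply/eqP => /(congr1 val) /=.
  have := ltn_ord i; rewrite leq_eqVlt => /predU1P[E|lt].
    by rewrite E modnn; lia.
  by rewrite modn_small //; lia.
(* The common neighbour [v j] joins two consecutive vertices in the square, which an anti-hole
   forbids. *)
have : @adj (square G) (v i) (v (ordS i)).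
  apply/square_adjP; split; last by right; exists (v j); rewrite (adj_sym (v j)).
  by rewrite (inj_eq v_inj).
by rewrite adjv /cycle_rel /= iSi eqxx.
Qed.

End Bipartite.

(** Replaces the isomorphism on a subtype by a cyclic enumeration of [W] inside [H], which can be
    composed with membership in a side or lifted to an induced subgraph. *)
Lemma antiholeP (H : sgraph) (W : {set H}) :
  is_antihole (induced W) <->
  exists2 n, 4 <= n & exists v : 'I_n -> H,
    [/\ injective v, W = v @: [set: 'I_n]
      & forall i j, adj (v i) (v j) = (i != j) && ~~ cycle_rel i j].
Proof.
split=> [[n n_ge4 [f [g fK gK] fadj]]|[n n_ge4 [v [v_inj -> vadj]]]].
  exists n => //; exists (fun i => val (g i)); split.
  - by move=> i j /val_inj /(can_inj gK).
  - apply/setP=> x; apply/idP/imsetP => [xW|[i _ ->]]; last exact: (valP (g i)).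
    by exists (f (Sub x xW)); rewrite ?inE // fK.
  - move=> i j; have [->|ij] := eqVneq i j; first exact: adj_irrefl.
    have := fadj (g i) (g j); rewrite !gK /= => ->; rewrite /compl_rel /=.
    by case: eqVneq => [/(can_inj gK) /eqP|_]; rewrite ?(negPf ij) //= negbK.
have vW i : v i \in v @: [set: 'I_n] by rewrite imset_f ?inE.
pose g i : {x | x \in v @: [set: 'I_n]} := Sub (v i) (vW i).
have g_inj : injective g by move=> i j /(congr1 val) /v_inj.
have [|f gK fK] := inj_card_bij g_inj.
  by rewrite card_sig card_imset // cardsT.
exists n => //; exists f; first by exists g.
move=> x y; rewrite -{2}(fK x) -{2}(fK y).
have [->|fxy] := eqVneq (f x) (f y); first by rewrite !adj_irrefl.
rewrite /= /compl_rel /= /induced_rel /= vadj fxy /= negbK.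
by case: eqVneq => // /g_inj /eqP; rewrite (negPf fxy).
Qed.

Lemma antihole_induced (H : sgraph) (A W : {set H}) :
  W \subset A -> is_antihole (induced W) ->
  is_antihole (induced [set x : induced A | val x \in W]).
Proof.
move=> /subsetP sWA /antiholeP[n n_ge4 [v [v_inj WE vadj]]].
have vW i : v i \in W by rewrite WE imset_f ?inE.
pose u i : induced A := Sub (v i) (sWA _ (vW i)).
apply/antiholeP; exists n => //; exists u; split => [i j /(congr1 val)/v_inj //||i j].
  apply/setP => x; rewrite inE; apply/idP/imsetP => [|[i _ ->]]; last exact: vW.
  by rewrite WE => /imsetP[i iT xE]; exists i => //; apply: val_inj.
exact: vadj.
Qed.

Lemma odd_antihole_gt5_free_subset (H : sgraph) (A W : {set H}) :
  odd_antihole_gt5_free (induced A) -> W \subset A ->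
  is_antihole (induced W) -> odd #|W| -> 5 < #|W| -> False.
Proof.
move=> freeA sWA antiW oddW W_gt5.
suff cardW : #|[set x : induced A | val x \in W]| = #|W|.
  by case: freeA; eexists; split; first exact: antihole_induced sWA antiW;
     rewrite cardW.
rewrite -(card_imset _ (@val_inj _ _ {x | x \in A})); apply: eq_card => y.
apply/imsetP/idP => [[x + ->]|yW]; first by rewrite inE.
by exists (Sub y (subsetP sWA y yW)); rewrite ?inE.
Qed.

Theorem theorem5 : partite_testable bipartite odd_antihole_gt5_free.
Proof.
move=> G A B _ AB freeA freeB [W [antiW oddW W_gt5]].
have [n _ [v [v_inj WE vadj]]] := (antiholeP W).1 antiW.
have cardW : #|W| = n by rewrite WE card_imset // cardsT card_ord.
(* Oddness excludes size 6. *)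
have n_gt6 : 6 < n by lia.
have oddn : odd n by rewrite -cardW.
have sideE := flanked_const oddn n_gt6
  (square_antihole_flanked AB (ltn_trans (isT : 1 < 6) n_gt6) v_inj vadj).
have i0 : 'I_n by apply: (@Ordinal _ 0); lia.
have [vA|vA] := boolP (v i0 \in A).
  apply: (odd_antihole_gt5_free_subset freeA _ antiW oddW W_gt5).
  by apply/subsetP=> x; rewrite WE => /imsetP[i _ ->]; rewrite (sideE i i0).
apply: (odd_antihole_gt5_free_subset freeB _ antiW oddW W_gt5).
apply/subsetP=> x; rewrite WE => /imsetP[i _ ->].
by rewrite (bipartition_compl AB) (sideE i i0).
Qed.
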